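(* Let $R$ be a local domain whose residue field $k$ has characteristic $0$. Let $S/R$ be a simple extension of degree $n$, and let $q$ be a regular quadratic form over $R$ of rank $m$. Then $N^S_R(D(q_S))\subset D(q)$, where $N^S_R$ is the norm map of $S/R$, $D(q_S)$ is the subgroup of $S^*$ generated by the invertible elements of $S$ of the form $q_S(x)$ with $x\in S^m$, and $D(q)$ is the subgroup of $R^*$ generated by the invertible elements of $R$ of the form $q(y)$ with $y\in R^m$.
   Context: All rings are commutative with unit. A ring extension $S/R$ is a ring $S$ with a ring monomorphism $R\to S$. A ring extension $S/R$ is a simple extension of degree $n$ if there is $c\in S^*$ (an invertible element, called a primitive element) such that $S$ is a free $R$-module with basis $1,c,\dots,c^{n-1}$. For an extension $S/R$ with $S$ free of finite rank as an $R$-module, the norm $N^S_R(s)$ is the determinant of the $R$-linear map $S\to S$ given by multiplication by $s$. $q_S=q\otimes_R S$ denotes the base change of $q$ to $S$ (the same quadratic form, with coefficients in $R$, evaluated on $S^m$). *)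

(* Defs.v *)
From HB Require Import structures.
From mathcomp Require Import all_boot all_order all_algebra.
Set Implicit Arguments. Unset Strict Implicit. Unset Printing Implicit Defensive.
Import Order.TTheory GRing.Theory Num.Theory.
Local Open Scope ring_scope.

Definition local_ring (R : comUnitRingType) : Prop :=
  (1 : R) != 0 /\
  forall x y : R, x \isn't a GRing.unit -> y \isn't a GRing.unit ->
                  x + y \isn't a GRing.unit.

(* The residue field R/m has characteristic 0: for every k >= 1,
   k*1 is not in the maximal ideal, i.e. is a unit of the local ring R. *)
Definition residue_char0 (R : comUnitRingType) : Prop :=
  forall k : nat, (k.+1)%:R \is a (@GRing.unit R).

Definition simple_extension (R S : comUnitRingType) (f : {rmorphism R -> S})
    (n : nat) (c : S) : Prop :=
  [/\ c \is a GRing.unit,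
      (forall s : S, exists a : 'I_n -> R, s = \sum_(i < n) f (a i) * c ^+ i) &
      (forall a : 'I_n -> R, \sum_(i < n) f (a i) * c ^+ i = 0 ->
                             forall i, a i = 0)].

Definition mul_matrix (R S : comUnitRingType) (f : {rmorphism R -> S})
    (n : nat) (c s : S) (A : 'M[R]_n) : Prop :=
  forall j : 'I_n, s * c ^+ j = \sum_(i < n) f (A i j) * c ^+ i.

Definition is_norm (R S : comUnitRingType) (f : {rmorphism R -> S})
    (n : nat) (c s : S) (r : R) : Prop :=
  exists A : 'M[R]_n, mul_matrix f c s A /\ r = \det A.

Definition qform (T : comRingType) (m : nat) (Q : 'M[T]_m) (x : 'rV[T]_m) : T :=
  (x *m Q *m x^T) 0 0.

(* Regular: the polar bilinear form b(x,y) = q(x+y)-q(x)-q(y),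
   with Gram matrix Q + Q^T, is nondegenerate (unimodular). *)
Definition regular_qform (R : comUnitRingType) (m : nat) (Q : 'M[R]_m) : Prop :=
  \det (Q + Q^T) \is a GRing.unit.

Inductive gen_units (T : unitRingType) (P : T -> Prop) : T -> Prop :=
| gen_units1 : gen_units P 1
| gen_unitsM x y : P x -> x \is a GRing.unit -> gen_units P y -> gen_units P (x * y)
| gen_unitsV x y : P x -> x \is a GRing.unit -> gen_units P y -> gen_units P (x^-1 * y).

Definition Dq (T : comUnitRingType) (m : nat) (Q : 'M[T]_m) : T -> Prop :=
  gen_units (fun u => exists x : 'rV[T]_m, u = qform Q x).

(* Main.v *)
Require Import Defs.
From HB Require Import structures.
From mathcomp Require Import all_boot all_order all_algebra.
From mathcomp Require Import generic_quotient ring_quotient qpoly fieldext ring.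
From Stdlib Require Import Classical.
Set Implicit Arguments. Unset Strict Implicit. Unset Printing Implicit Defensive.
Import GRing.Theory.
Local Open Scope ring_scope.

(** By multiplicativity of the norm it suffices to treat [s = q(x)].  Ranks 0
    and 1 are immediate, so let the rank be at least 2.

    Twisting [x] by [c + z], for a generic integer [z], replaces [s] by
    [s (c + z)^2] and makes it a primitive element of [S/R]; the norm changes by
    the square of a unit of [R], which lies in [D(q)].  So we may assume
    [S = R[t]/p] with [s = t], i.e. [q(v(t)) = t + p(t) h(t)] for a polynomial
    vector [v] of degree less than [n = deg p], and the norm is [(-1)^n p(0)].

    If [q(v(0))] and [q(v_(n-1))] are units, then [h] has degree [n - 2],
    leading coefficient [q(v_(n-1))] and [p(0) h(0) = q(v(0))], while [t] is
    again a value of [q] modulo [h]: induction on [n] applies.  To reach that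
    situation, [v] is modified by reflections of [q] over [R[t]/p], which keep
    [q(v)]; a suitable vector of reflection is found over the residue field,
    where the obstruction is the vanishing of a nonzero polynomial in one
    parameter. *)

(** * Residue field and splitting fields *)

Section ResidueField.
Local Open Scope quotient_scope.
Variables (R : comUnitRingType) (locR : local_ring R).

Definition nonunits := [pred x : R | x \isn't a GRing.unit].

Fact nonunits_idealr_closed : idealr_closed nonunits.
Proof.
case: locR => _ addN; split=> [||a x y]; rewrite ?inE ?unitr0 ?unitr1 //.
by move=> xN yN; apply: addN => //; rewrite unitrM (negPf xN) andbF.
Qed.

HB.instance Definition _ := isIdealr.Build R nonunits nonunits_idealr_closed.

Definition residue_ring := {ideal_quot (nonunits : idealr R)}.

HB.instance Definition _ := GRing.ComNzRing.on residue_ring.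

Definition residue_inv (x : residue_ring) : residue_ring :=
  if x == 0 then 0 else \pi_residue_ring (repr x)^-1.

Fact residue_eq0 (x : R) :
  (\pi_residue_ring x == 0) = (x \isn't a GRing.unit).
Proof.
have -> : (0 : residue_ring) = \pi_residue_ring 0 by rewrite rmorph0.
by rewrite -Quotient.idealrBE subr0.
Qed.

Fact residue_mulVf (x : residue_ring) : x != 0 -> residue_inv x * x = 1.
Proof.
move=> x0; rewrite /residue_inv (negPf x0) -{2}[x]reprK -rmorphM /=.
by rewrite mulVr ?rmorph1 //; rewrite -[x]reprK residue_eq0 negbK in x0.
Qed.

Fact residue_inv0 : residue_inv 0 = 0.
Proof. by rewrite /residue_inv eqxx. Qed.

HB.instance Definition _ :=
  GRing.ComNzRing_isField.Build residue_ring residue_mulVf residue_inv0.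

(** Surjectivity and the detection of units are all that later arguments use of the quotient by the
    nonunits. *)
Lemma residue_field_exists :
  exists (k : fieldType) (pi : {rmorphism R -> k}),
    (forall y, exists x, pi x = y) /\
    (forall x, (pi x != 0) = (x \is a GRing.unit)).
Proof.
exists (residue_ring : fieldType), (\pi_residue_ring : {rmorphism R -> residue_ring}); split.
  by move=> y; exists (repr y); apply: reprK.
by move=> x; rewrite -[_ \in _]negbK -residue_eq0.
Qed.
End ResidueField.

Lemma irreducible_factor_exists (F : fieldType) (p : {poly F}) :
  (1 < size p)%N -> exists2 q, irreducible_poly q & q %| p.
Proof.
have [n] := ubnP (size p); elim: n p => // n IHn p lt_pn sp.
have [irr|nirr] := classic (irreducible_poly p); first by exists p.
have [q [sq qp nqp]] : exists q : {poly F}, [/\ size q != 1%N, q %| p & ~~ (q %= p)].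
  apply: NNPP => H; apply: nirr; split=> // q sq qp.
  by case: (boolP (q %= p)) => // nqp; case: H; exists q.
have p0 : p != 0 by rewrite -size_poly_gt0 ltnW.
have q0 : q != 0 by apply: contraTneq qp => ->; rewrite dvd0p.
have lt_qp : (size q < size p)%N.
  by rewrite ltn_neqAle dvdp_leq // dvdp_size_eqp // nqp.
have [||r irr rq] := IHn q; first exact: leq_trans lt_qp _.
  by rewrite ltn_neqAle eq_sym sq size_poly_gt0.
by exists r => //; apply: dvdp_trans qp.
Qed.

(** A root of an irreducible factor is adjoined, its linear factor is divided out, and the induction
    continues over the larger field; this is why [F] varies in it. *)
Lemma splitting_field_exists (F : fieldType) (p : {poly F}) :
  p \is monic ->
  exists (L : fieldType) (i : {rmorphism F -> L}) (rs : seq L),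
    map_poly i p = \prod_(a <- rs) ('X - a%:P).
Proof.
have [n] := ubnP (size p); elim: n F p => // n IHn F p lt_pn mp.
have [sp|sp] := leqP (size p) 1.
  exists F, idfun, [::]; rewrite big_nil map_poly_id //.
  have /eqP sp1 : size p == 1%N by rewrite eqn_leq sp size_poly_gt0 monic_neq0.
  have [c _ pc] := size_poly1P _ (introT eqP sp1).
  by move: mp; rewrite pc monicE lead_coefC => /eqP ->.
have [q irr qp] := irreducible_factor_exists sp.
have [L _ [z rz _]] := irredp_FAdjoin irr.
have /factor_theorem [p1 Dp] : root (map_poly (in_alg L) p) z.
  by move: qp => /dvdpP[r ->]; rewrite rmorphM rootM rz orbT.
have mp1 : p1 \is monic.
  have := mp; rewrite -(map_monic (in_alg L)) Dp monicMr //.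
  exact: monicXsubC.
have [|K [i [rs Drs]]] := IHn L p1 _ mp1.
  have := congr1 (size \o polyseq) Dp => /=.
  rewrite size_map_poly size_mul ?monic_neq0 ?monicXsubC // size_XsubC addn2 /= => sz.
  by rewrite sz in lt_pn.
exists K, (i \o in_alg L : {rmorphism F -> K}), (i z :: rs).
rewrite big_cons -Drs map_poly_comp Dp rmorphM /= rmorphB /= map_polyX map_polyC.
by rewrite mulrC.
Qed.

(** * Polynomials modulo a monic polynomial *)

Lemma monic_dvdP (R : idomainType) (p f : {poly R}) :
  p \is monic -> reflect (exists g, f = g * p) (p %| f).
Proof.
move=> mp; apply: (iffP idP) => [pf|[g ->]]; last exact: dvdp_mull.
by exists (f %/ p); rewrite {1}(Pdiv.IdomainMonic.divp_eq mp f) (modp_eq0 pf) addr0.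
Qed.

Lemma horner_mx_comp (R : comNzRingType) n (C : 'M[R]_n.+1) (f g : {poly R}) :
  horner_mx C (f \Po g) = horner_mx (horner_mx C g) f.
Proof.
elim/poly_ind: f => [|f a IHf]; first by rewrite comp_poly0 !rmorph0.
rewrite comp_polyD comp_polyM comp_polyX comp_polyC !rmorphD !rmorphM /= IHf.
by rewrite horner_mx_X !horner_mx_C.
Qed.

(** The columns are the vectors [C^j e_0]. When [C] is multiplication by [s] in the basis of powers
    of [c], [e_0] stands for 1 and column [j] holds the coordinates of [s^j]; invertibility then
    says that the powers of [s] form a basis. *)
Definition krylov (R : pzRingType) n (C : 'M[R]_n.+1) : 'M[R]_n.+1 :=
  \matrix_(i, j) (C ^+ j) i 0.

Lemma krylov_horner (R : comNzRingType) n (C : 'M[R]_n.+1) (w : 'rV[R]_n.+1) :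
  col 0 (horner_mx C (rVpoly w)) = krylov C *m w^T.
Proof.
apply/colP=> i; rewrite horner_rVpoly mulmx_sum_row linear_sum /= !mxE summxE.
by apply: eq_bigr => j _; rewrite linearZ /= rowK mxvecK !mxE mulrC.
Qed.

Lemma map_krylov (R R' : comNzRingType) (phi : {rmorphism R -> R'}) n (C : 'M[R]_n.+1) :
  krylov (map_mx phi C) = map_mx phi (krylov C).
Proof. by apply/matrixP=> i j; rewrite !mxE -rmorphXn /= mxE. Qed.

(** By Cayley-Hamilton, [f] may be replaced by its remainder modulo the characteristic polynomial.
    The coefficients of the remainder form a vector killed by [krylov C], hence zero. *)
Lemma char_poly_dvd_krylov (R : idomainType) n (C : 'M[R]_n.+1) (f : {poly R}) :
  krylov C \in unitmx -> col 0 (horner_mx C f) = 0 -> char_poly C %| f.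
Proof.
move=> unitK; set p := char_poly C.
have mp : p \is monic by apply: char_poly_monic.
rewrite {1}(Pdiv.IdomainMonic.divp_eq mp f) rmorphD rmorphM /= Cayley_Hamilton.
rewrite mulr0 add0r; set r := f %% p => r0.
have sr : (size r <= n.+1)%N.
  by rewrite -ltnS -(size_char_poly C) ltn_modp monic_neq0.
suff: r = 0 by move/eqP.
rewrite -(poly_rV_K sr) in r0 *; move: r0; rewrite krylov_horner.
move/(canRL (mulKmx unitK)); rewrite mulmx0 => /(congr1 trmx).
by rewrite trmxK trmx0 => ->; rewrite linear0.
Qed.

(** Transposition turns the row rule [e_j C = e_(j+1)] of [companionmx] into a column rule, which
    makes the Krylov matrix the identity. *)
Lemma companion_exists (R : comNzRingType) n (p : {poly R}) :
  p \is monic -> size p = n.+2 ->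
  exists2 C : 'M[R]_n.+1, char_poly C = p & krylov C = 1%:M.
Proof.
move=> mp sp.
(* Both facts stay in one hypothesis, so that rewriting the size of [p] changes the dimension of the
   matrix in both at once. *)
have := conj (companionmxK mp) (@mulmx_delta_companion R p).
move: (companionmx p); rewrite sp /= => C [chC stepC].
exists C^T.
  by rewrite -chC /char_poly -[RHS]det_tr /char_poly_mx linearB /= tr_scalar_mx map_trmx.
have rowC j (ltj : (j < n.+1)%N) : row 0 (C ^+ j) = delta_mx 0 (Ordinal ltj).
  elim: j ltj => [|j IHj] ltj.
    by rewrite expr0 row1; congr (delta_mx _ _); apply: val_inj.
  have ltj' : (j < n.+1)%N by apply: ltnW.
  by rewrite exprSr row_mul (IHj ltj') (stepC (Ordinal ltj') ltj).
have trX j : (C^T) ^+ j = (C ^+ j)^T.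
  elim: j => [|j IHj]; first by rewrite !expr0 trmx1.
  by rewrite exprS IHj exprSr -!mulmxE trmx_mul.
apply/matrixP=> i j; have /rowP/(_ i) := rowC j (ltn_ord j).
rewrite !mxE trX mxE => ->.
by congr (_%:R); rewrite eqxx /= -val_eqE.
Qed.

(** [C] is multiplication by [t] on [R[t]/p], so [horner_mx C f] is multiplication by [f], and
    Cayley-Hamilton makes its characteristic polynomial vanish at [f] modulo [p]. *)
Lemma char_poly_mod (R : idomainType) n (p f : {poly R}) :
  p \is monic -> size p = n.+2 ->
  exists C : 'M[R]_n.+1, char_poly C = p /\
    p %| char_poly (horner_mx C f) \Po f.
Proof.
move=> mp sp; have [C chC krC] := companion_exists mp sp.
exists C; split=> //; rewrite -{1}chC; apply: char_poly_dvd_krylov.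
  by rewrite krC unitmx1.
by rewrite horner_mx_comp Cayley_Hamilton linear0.
Qed.

(** The determinant of multiplication by [f] is a unit because its reduction is one. Writing the
    characteristic polynomial as [chi1 X + chi_0] with [chi_0] a unit, its vanishing at [f] gives
    the inverse [- chi1(f) / chi_0]. *)
Lemma inverse_mod_lift (R : idomainType) (k : fieldType)
    (pi : {rmorphism R -> k}) n (p f : {poly R}) (g : {poly k}) :
  (forall x, (pi x != 0) = (x \is a GRing.unit)) ->
  p \is monic -> size p = n.+2 ->
  map_poly pi p %| map_poly pi f * g - 1 ->
  exists h, p %| f * h - 1.
Proof.
move=> pi_unit mp sp.
have [C [chC]] := char_poly_mod f mp sp; set chi := char_poly _.
have mpk : map_poly pi p \is monic by apply: monic_map.
move=> dvd_chi /(monic_dvdP _ mpk)[b fg].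
have det_unit : \det (horner_mx C f) \is a GRing.unit.
  rewrite -pi_unit -det_map_mx map_horner_mx.
  have /(congr1 (horner_mx (map_mx pi C))) := fg.
  rewrite rmorphB !rmorphM /= rmorph1 -chC map_char_poly Cayley_Hamilton mulr0.
  move/eqP; rewrite subr_eq0 => /eqP/(congr1 determinant).
  rewrite -mulmxE det_mulmx det1; apply: contra_eq_neq => ->.
  by rewrite mul0r eq_sym oner_eq0.
have chi0_unit : chi`_0 \is a GRing.unit.
  by rewrite char_poly_det unitrM unitrX ?unitrN1.
have [chi1 Dchi] : exists chi1, chi = chi1 * 'X + (chi`_0)%:P.
  by move: chi {dvd_chi chi0_unit}; elim/poly_ind => [|c a _];
   [exists 0|exists c]; rewrite ?mul0r ?coef0 ?addr0 // coefD coefMX coefC add0r.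
exists (- (chi`_0)^-1 *: (chi1 \Po f)).
move: dvd_chi => /(monic_dvdP _ mp)[h]; rewrite Dchi comp_polyD comp_polyM comp_polyX comp_polyC.
rewrite -Dchi => /(canRL (addrK _)) Dh.
apply/(monic_dvdP _ mp); exists (- (chi`_0)^-1 *: h).
rewrite -scalerAr [f * _]mulrC Dh scalerBr -scalerAl !scaleNr scale_polyC.
by rewrite mulVr // opprK addrK.
Qed.

(** * Quadratic forms *)

Section Polar.
Variables (T : comNzRingType) (m : nat) (Q : 'M[T]_m).
Implicit Types x y u : 'rV[T]_m.

Definition polar x y : T := (x *m (Q + Q^T) *m y^T) 0 0.

Fact mx11_tr (M : 'M[T]_1) : M 0 0 = M^T 0 0. Proof. by rewrite mxE. Qed.

Lemma polarC x y : polar x y = polar y x.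
Proof.
by rewrite /polar [RHS]mx11_tr !trmx_mul trmxK [(Q + _)^T]linearD /= trmxK [Q^T + Q]addrC mulmxA.
Qed.

Lemma polarDr x y u : polar x (y + u) = polar x y + polar x u.
Proof. by rewrite /polar [(y + u)^T]linearD /= mulmxDr mxE. Qed.

Lemma polarZr a x y : polar x (a *: y) = a * polar x y.
Proof. by rewrite /polar [(a *: y)^T]linearZ /= -scalemxAr mxE. Qed.

Lemma polarDl x y u : polar (x + y) u = polar x u + polar y u.
Proof. by rewrite !(polarC _ u) polarDr. Qed.

Lemma polarZl a x y : polar (a *: x) y = a * polar x y.
Proof. by rewrite !(polarC _ y) polarZr. Qed.

Lemma qformD x y : qform Q (x + y) = qform Q x + qform Q y + polar x y.
Proof.
have -> : polar x y = (x *m Q *m y^T) 0 0 + (y *m Q *m x^T) 0 0.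
  rewrite /polar mulmxDr mulmxDl mxE; congr (_ + _).
  by rewrite [RHS]mx11_tr !trmx_mul trmxK mulmxA.
by rewrite /qform [(x + y)^T]linearD /= !mulmxDl !mulmxDr !mxE; ring.
Qed.

Lemma qformZ a x : qform Q (a *: x) = a ^+ 2 * qform Q x.
Proof. by rewrite /qform [(a *: x)^T]linearZ /= -!scalemxAl -scalemxAr !mxE mulrA expr2. Qed.

Lemma polarxx x : polar x x = 2 * qform Q x.
Proof.
have := qformD x x; have -> : x + x = 2 *: x by rewrite scaler_nat mulr2n.
rewrite qformZ => H; apply: (addrI (qform Q x + qform Q x)).
by rewrite -H; ring.
Qed.

Lemma qform0 : qform Q 0 = 0.
Proof. by rewrite /qform !mul0mx mxE. Qed.

End Polar.

Lemma map_qform (T U : comNzRingType) (f : {rmorphism T -> U}) m (Q : 'M_m) x :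
  f (qform Q x) = qform (map_mx f Q) (map_mx f x).
Proof. by rewrite /qform !map_trmx -!map_mxM [RHS]mxE. Qed.

Lemma map_polar (T U : comNzRingType) (f : {rmorphism T -> U}) m (Q : 'M_m) x y :
  f (polar Q x y) = polar (map_mx f Q) (map_mx f x) (map_mx f y).
Proof. by rewrite /polar !map_trmx -map_mxD -!map_mxM [RHS]mxE. Qed.

Lemma polar_nondegenerate (T : comUnitRingType) m (Q : 'M[T]_m) (w : 'rV_m) :
  regular_qform Q -> (forall y, polar Q w y = 0) -> w = 0.
Proof.
move=> regQ wperp; suff: w *m (Q + Q^T) = 0.
  by move/(canRL (mulmxK regQ)); rewrite mul0mx.
apply/rowP=> i; rewrite !mxE; have := wperp (delta_mx 0 i).
rewrite /polar trmx_delta !mxE (bigD1 i) //= big1; last first.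
  by move=> j ji; rewrite [X in _ * X]mxE eqxx andbT (negPf ji) mulr0.
by rewrite [X in _ * X]mxE !eqxx mulr1 addr0 mxE.
Qed.

(** In characteristic 0 the integers below [size p] are pairwise distinct, and [p] has fewer roots
    than that. This supplies every generic integer chosen later. *)
Lemma nat_nonroot (F : fieldType) (p : {poly F}) :
  (forall n, n.+1%:R != 0 :> F) -> p != 0 -> exists z : nat, p.[z%:R] != 0.
Proof.
move=> char0 p0; apply: NNPP => H.
have roots z : root p z%:R.
  by apply/negPn/negP => rz; apply: H; exists z.
pose s := [seq z%:R | z <- iota 0 (size p)] : seq F.
have s_roots : all (root p) s by apply/allP=> _ /mapP[z _ ->].
suff /(max_poly_roots p0 s_roots) : uniq s by rewrite size_map size_iota ltnn.
rewrite map_inj_in_uniq ?iota_uniq // => a b _ _.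
wlog: a b / (a <= b)%N => [wl|le_ab].
  by case/orP: (leq_total a b) => le eqab; [|symmetry]; apply: wl.
move/eqP; rewrite eq_sym -subr_eq0 -natrB //.
case: (b - a)%N (subnKC le_ab) => [|n]; first by rewrite addn0.
by rewrite (negPf (char0 n)).
Qed.

(** * Reflections in general position *)

Section GenericReflection.
Variables (k : fieldType) (A : comUnitAlgType k) (m : nat) (Q : 'M[k]_m.+2).
Hypotheses (char0 : forall n, n.+1%:R != 0 :> k) (regQ : regular_qform Q).
Hypothesis algA :
  forall s : A, exists2 chi : {poly k}, chi \is monic & root (map_poly (in_alg A) chi) s.

Local Notation QA := (map_mx (in_alg A) Q).

(** Equivalently, the pairing [lam (r * s)] has zero kernel, as for the linear form of a Frobenius
    algebra. *)
Definition nondegenerate_functional (lam : A -> k) :=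
  forall s, (forall r, lam (r * s) = 0) -> s = 0.

Lemma functional_polar (lam : {linear A -> k^o}) (e : 'rV[k]_m.+2) u :
  lam (polar QA (map_mx (in_alg A) e) u) = polar Q e (map_mx lam u).
Proof.
rewrite /polar !map_trmx -map_mxD -map_mxM !mxE raddf_sum /=.
apply: eq_bigr => i _; rewrite !mxE in_algE mulr_algl linearZ /=.
by [].
Qed.

Lemma natr_unit n : n.+1%:R \is a @GRing.unit A.
Proof.
rewrite -(rmorph_nat (in_alg A)); apply: rmorph_unit.
by rewrite unitfE char0.
Qed.

Section Perp.
Variables (x : 'rV[A]_m.+2) (lam : {linear A -> k^o}).
Hypotheses (qx_unit : qform QA x \is a GRing.unit)
  (lam_nd : nondegenerate_functional lam).

(** The denominator is [polar x x]: this is the projection onto the orthogonal complement of [x]. *)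
Definition perp_proj y := y - (polar QA x y / (2 * qform QA x)) *: x.

Let two_q_unit : 2 * qform QA x \is a GRing.unit.
Proof. by rewrite unitrM qx_unit (natr_unit 1). Qed.

Lemma polar_perp_proj y : polar QA x (perp_proj y) = 0.
Proof.
by rewrite polarDr -scaleNr polarZr polarxx mulNr divrK ?subrr.
Qed.

Lemma perp_proj_adjoint y u :
  polar QA y (perp_proj u) = polar QA (perp_proj y) u.
Proof.
rewrite polarDr polarDl -!scaleNr polarZr polarZl (polarC _ y x); ring.
Qed.

(** Since the projection is self-adjoint and [lam] is nondegenerate, the projection of [e] vanishes,
    so [e = rho x] over [A]. Then [rho^2 q(x) = q(e) = 0] gives [rho^2 = 0]; the coordinates of [e]
    have square zero and lie in a field. *)
Lemma isotropic_perp_eq0 (e : 'rV[k]_m.+2) :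
  qform Q e = 0 ->
  (forall u, polar QA x u = 0 -> polar Q e (map_mx lam u) = 0) -> e = 0.
Proof.
move=> qe0 eperp; set eA := map_mx (in_alg A) e.
have w0 : perp_proj eA = 0.
  apply: (@polar_nondegenerate _ _ QA).
    rewrite /regular_qform map_trmx -map_mxD det_map_mx.
    exact: rmorph_unit.
  move=> y; apply: lam_nd => s.
  rewrite -perp_proj_adjoint -polarZr functional_polar eperp //.
  by rewrite polarZr polar_perp_proj mulr0.
move/eqP: w0; rewrite subr_eq0 => /eqP; set rho := _ / _ => eAx.
have rho2 : rho ^+ 2 = 0.
  have := congr1 (qform QA) eAx.
  rewrite qformZ -map_qform qe0 rmorph0 => /esym.
  by move/(canRL (mulrK qx_unit)); rewrite mul0r.
apply/rowP=> i; rewrite !mxE.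
have := congr1 (fun v : 'rV_m.+2 => v 0 i ^+ 2) eAx.
rewrite /= !mxE exprMn rho2 mul0r -rmorphXn => /eqP.
by rewrite fmorph_eq0 expf_eq0 /= => /eqP.
Qed.

(** If no such [u] existed, [lam] would kill the whole orthogonal complement of [x], which would
    then be zero, and every vector would be a multiple of [x]. *)
Lemma perp_direction : qform Q (map_mx lam x) = 0 ->
  exists u, polar QA x u = 0 /\
    (polar Q (map_mx lam x) (map_mx lam u) != 0 \/
     map_mx lam x = 0 /\ qform Q (map_mx lam u) != 0).
Proof.
move=> qe0; apply: NNPP => H.
have e0 : map_mx lam x = 0.
  apply: isotropic_perp_eq0 => // u xu; apply/eqP/negPn/negP => pn.
  by apply: H; exists u; split=> //; left.
have q0 u : polar QA x u = 0 -> qform Q (map_mx lam u) = 0.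
  move=> xu; apply/eqP/negPn/negP => qn.
  by apply: H; exists u; split=> //; right.
(* Polarization: [q] vanishes on the image under [lam] of the complement of [x], hence so does its
   polar form, and [isotropic_perp_eq0] applies to [lam u]. *)
have lam0 u : polar QA x u = 0 -> map_mx lam u = 0.
  move=> xu; apply: isotropic_perp_eq0 => [|v xv]; first exact: q0.
  have := q0 (u + v); rewrite polarDr xu xv addr0 map_mxD qformD !q0 // !add0r.
  by apply.
have proj0 y : perp_proj y = 0.
  apply/rowP=> i; rewrite [RHS]mxE; apply: lam_nd => s.
  have := lam0 (s *: perp_proj y); rewrite polarZr polar_perp_proj mulr0.
  by move=> /(_ erefl)/rowP/(_ i); rewrite !mxE.
(* In rank at least 2, two coordinate vectors cannot both be multiples of [x]. *)
have dx i : exists r, delta_mx 0 i = r *: x.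
  by have /eqP := proj0 (delta_mx 0 i); rewrite subr_eq0 => /eqP ->; eexists.
have [r0 /rowP D0] := dx 0; have [r1 /rowP D1] := dx 1.
have E00 : 1 = r0 * x 0 0 by have := D0 0; rewrite !mxE.
have E01 : 0 = r0 * x 0 1 by have := D0 1; rewrite !mxE.
have E11 : 1 = r1 * x 0 1 by have := D1 1; rewrite !mxE.
have /eqP : (1 : A) = (r1 * x 0 0) * (r0 * x 0 1).
  by rewrite -[LHS]mulr1 {1}E00 E11; ring.
by rewrite -E01 mulr0 oner_eq0.
Qed.

End Perp.

(** The three cases exhibit a nonzero lowest coefficient: [q(e)] in degree 0, [polar e d] in degree
    1, [q(d)] in degree 2. *)
Lemma qform_poly_neq0 (e d : 'rV[k]_m.+2) (w : 'rV[{poly k}]_m.+2) :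
  [\/ qform Q e != 0, qform Q e = 0 /\ polar Q e d != 0 | e = 0 /\ qform Q d != 0] ->
  qform (map_mx polyC Q)
    (map_mx polyC e + 'X *: (map_mx polyC d + 'X *: w)) != 0.
Proof.
move=> H; set w1 := _ + 'X *: w.
have w1_0 : map_mx (horner_eval 0) w1 = d.
  by apply/rowP=> i; rewrite !mxE /horner_eval !hornerE.
have QE : map_mx (horner_eval 0) (map_mx polyC Q) = Q.
  by apply/matrixP=> i j; rewrite !mxE /horner_eval hornerC.
have eE : map_mx (horner_eval 0) (map_mx polyC e) = e.
  by apply/rowP=> i; rewrite !mxE /horner_eval hornerC.
have X0 : horner_eval (0 : k) 'X = 0 by rewrite /horner_eval hornerX.
rewrite qformD qformZ polarZr -map_qform; case: H => [qe|[qe pe]|[e0 qd]].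
- apply: contraNneq qe => /(congr1 (horner_eval 0)); rewrite /horner_eval !hornerE.
  by rewrite expr0n !mul0r !addr0 => ->.
- rewrite qe rmorph0 add0r expr2 -mulrA -mulrDr mulf_neq0 ?polyX_eq0 //.
  apply: contraNneq pe => /(congr1 (horner_eval 0)).
  rewrite rmorphD rmorphM /= X0 mul0r add0r map_polar.
  by rewrite QE w1_0 eE /horner_eval horner0 => ->.
rewrite e0 qform0 rmorph0 map_mx0 add0r -[polar _ 0 w1]mulr1.
have -> : polar (map_mx polyC Q) 0 w1 = 0 by rewrite /polar !mul0mx mxE.
rewrite mul0r mulr0 addr0 mulf_neq0 ?expf_neq0 ?polyX_eq0 //.
apply: contraNneq qd => /(congr1 (horner_eval 0)).
by rewrite map_qform QE w1_0 /horner_eval horner0 => ->.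
Qed.

(** Put [U = - X^2]. Then [U^d chi(1/U)] has coefficients in [k] and constant term [chi_d], while
    [U^d (chi(1/U) - chi(theta))] is divisible by [U (1/U - theta) = 1 + theta X^2]. *)
Lemma reversed_poly_factor (theta : A) d (chi : {poly k}) :
  (size chi <= d.+1)%N ->
  exists (N : {poly k}) (G : {poly A}),
    (1 + theta%:P * 'X^2) * G =
      map_poly (in_alg A) ((chi`_d)%:P + 'X^2 * N)
      - (- 'X^2) ^+ d * (map_poly (in_alg A) chi).[theta]%:P.
Proof.
elim: d chi => [|d IHd] chi.
  move/size1_polyC ->; exists 0, 0; rewrite coefC /= !mulr0 addr0 expr0 mul1r.
  by rewrite !map_polyC hornerC subrr.
elim/poly_ind: chi => [|chi b _] s_chi.
  by exists 0, 0; rewrite coef0 !mulr0 addr0 !rmorph0 horner0 mulr0 subr0.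
have /IHd[N [G EG]] : (size chi <= d.+1)%N.
  by move: s_chi; rewrite size_MXaddC; case: eqVneq => [->|]; rewrite ?size_poly0.
exists (N - (- 'X^2) ^+ d * b%:P).
exists (G + (- 'X^2) ^+ d * (map_poly (in_alg A) chi).[theta]%:P).
rewrite mulrDr EG coefD coefMX coefC /= addr0.
rewrite !(rmorphD, rmorphB, rmorphM, rmorphN, rmorphXn) /= !map_polyX !map_polyC /=.
rewrite -expr2 hornerMXaddC polyCD polyCM [_ ^+ d.+1]exprS.
move: ((- 'X^2) ^+ d) => E.
ring.
Qed.

(* The rational function [(1 + theta z^2)^-1] has denominator in [k[z]],
   obtained by reversing a polynomial annihilating [theta]. *)
Lemma rational_inverse (theta : A) :
  exists (N : {poly k}) (G : {poly A}), N != 0 /\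
    (1 + theta%:P * 'X^2) * (1 + 'X^2 * G) = map_poly (in_alg A) N.
Proof.
have [chi mchi /rootP rchi] := algA theta.
have chiE : (size chi).-1.+1 = size chi by rewrite prednK // size_poly_gt0 monic_neq0.
have [|N [G]] := @reversed_poly_factor theta (size chi).-1 chi; first by rewrite chiE.
rewrite rchi mulr0 subr0 -[chi`__]/(lead_coef chi) (monicP mchi).
set NN := 1%:P + _ => EG; exists NN, (map_poly (in_alg A) N - theta%:P * G); split.
  apply/eqP => /(congr1 (horner^~ 0)); rewrite /NN !hornerE expr0n mul0r addr0.
  by move/eqP; rewrite oner_eq0.
suff -> : 1 + 'X^2 * (map_poly (in_alg A) N - theta%:P * G) = G by [].
have -> : 'X^2 * (map_poly (in_alg A) N - theta%:P * G) = map_poly (in_alg A) NN - 1 - theta%:P * 'X^2 * G.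
  by rewrite /NN rmorphD rmorphM /= rmorph1 map_polyXn; ring.
by rewrite -EG; ring.
Qed.

Lemma horner_map_functional (nu : {linear A -> k^o}) (P : {poly A}) (z : k) :
  (map_poly nu P).[z] = nu P.[z%:A].
Proof.
rewrite horner_coef (horner_coef P) raddf_sum.
rewrite (big_ord_widen _ (fun i => (map_poly nu P)`_i * z ^+ i) (size_poly _ _)).
rewrite big_mkcond; apply: eq_bigr => i _ /=.
have -> : P`_i * z%:A ^+ i = z ^+ i *: P`_i.
  by rewrite -in_algE -rmorphXn /= mulr_algr.
rewrite linearZ /= coef_map mulrC; case: ifP => // /negbT.
rewrite -leqNgt => /(nth_default 0); rewrite coef_map /= => ->.
by rewrite ?scaler0 ?mulr0 ?mul0r.
Qed.

(* With [y = x + z u] and [u] orthogonal to [x], the reflection of [x] is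
   [- ((1 - z^2 theta) x + 2 z u) / (1 + z^2 theta)], [theta = q u / q x];
   its functionals are rational in [z] and their lowest coefficients are
   read off from [perp_direction]. *)
Lemma generic_reflection (x : 'rV[A]_m.+2) (lam mu : {linear A -> k^o}) :
  qform QA x \is a GRing.unit -> nondegenerate_functional lam ->
  exists y g, let x' := x - (polar QA x y * g) *: y in
    [/\ qform QA y * g = 1, qform Q (map_mx lam x') != 0 &
        qform Q (map_mx mu x) != 0 -> qform Q (map_mx mu x') != 0].
Proof.
move=> qx_unit lam_nd.
have [qlx|qlx] := eqVneq (qform Q (map_mx lam x)) 0; last first.
  (* The reflection in [x] itself suffices here: it sends [x] to [-x] and changes neither value. *)
  exists x, (qform QA x)^-1 => /=; rewrite mulrV // polarxx mulrK //.
  have -> : x - 2 *: x = (-1) *: x by rewrite scaler_nat mulr2n opprD addNKr scaleN1r.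
  have E (nu : {linear A -> k^o}) : qform Q (map_mx nu (-1 *: x)) = qform Q (map_mx nu x).
    have -> : map_mx nu (-1 *: x) = -1 *: map_mx nu x.
      by apply/rowP=> i; rewrite !mxE !mulN1r linearN.
    by rewrite qformZ sqrrN expr1n mul1r.
  by rewrite !E.
have [u [xu u_good]] := perp_direction qx_unit lam_nd qlx.
pose theta := qform QA u / qform QA x.
have [N [G [N0 NG]]] := rational_inverse theta.
(* By [rational_inverse], [1 / (1 + theta z^2) = (1 + z^2 G) / N]. Multiplying the reflected vector
   by [-N] gives [x + 2 z u + z^2 r]; [r] collects all terms of order at least 2. *)
pose r : 'rV[{poly A}]_m.+2 := \row_i (- (theta * x 0 i)%:P +
  ((x 0 i)%:P - (theta * x 0 i)%:P * 'X^2 + (2 * u 0 i)%:P * 'X) * G).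
pose w (nu : {linear A -> k^o}) := map_mx polyC (map_mx nu x) +
  'X *: (map_mx polyC (2 *: map_mx nu u) + 'X *: map_mx (map_poly nu) r).
pose F nu := qform (map_mx polyC Q) (w nu).
have Flam : F lam != 0.
  apply: qform_poly_neq0; case: u_good => [pn|[e0 qn]].
    by constructor 2; split=> //; rewrite polarZr mulf_neq0 ?(char0 1).
  by constructor 3; split=> //; rewrite qformZ mulf_neq0 ?expf_neq0 ?(char0 1).
(* If the value at [mu x] is zero there is nothing to preserve, and the factor 1 imposes no
   condition on [z]. *)
pose Fmu := if qform Q (map_mx mu x) != 0 then F mu else 1.
have Fmu0 : Fmu != 0.
  rewrite /Fmu; case: ifP => [qm|_]; last exact: oner_neq0.
  by apply: qform_poly_neq0; constructor 1.
have [z] : exists z : nat, (N * F lam * Fmu).[z%:R] != 0.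
  by apply: nat_nonroot; rewrite ?mulf_neq0.
rewrite !hornerM !mulf_eq0 !negb_or; move: (z%:R) => {}z /andP[/andP[Nz Flz] Fmz].
have := congr1 (horner^~ z%:A) NG.
rewrite -in_algE horner_map /= !hornerE /=.
set za := z%:A; set Gz := G.[za] => NGz.
pose y := x + za *: u.
have xy : polar QA x y = 2 * qform QA x by rewrite polarDr polarZr xu mulr0 addr0 polarxx.
have qy : qform QA y = qform QA x * (1 + theta * za ^+ 2).
  rewrite qformD qformZ polarZr xu mulr0 addr0 mulrDr mulr1 mulrA [_ * theta]mulrC.
  by rewrite /theta divrK // mulrC.
pose g := (qform QA x)^-1 * ((1 + za ^+ 2 * Gz) * (N.[z]^-1)%:A).
exists y, g => /=.
have NNV : N.[z]%:A * (N.[z]^-1)%:A = 1 :> A.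
  by rewrite -!in_algE -rmorphM /= divff // scale1r.
set x' := x - _.
have x'E : N.[z]%:A *: x' = - (x + za *: (2 *: u + za *: map_mx (horner_eval za) r)) :> 'rV[A]_m.+2.
  have coefE : polar QA x y * g = 2 * (1 + za ^+ 2 * Gz) * (N.[z]^-1)%:A.
    by rewrite xy /g [LHS]mulrA mulrK // mulrA.
  rewrite /x' coefE; apply/rowP=> i.
  rewrite !mxE /horner_eval !hornerE -/za -/Gz mulrBr.
  rewrite [X in _ - X](_ : _ = N.[z]%:A * (N.[z]^-1)%:A *
    (2 * (1 + za ^+ 2 * Gz) * (x 0 i + za * u 0 i))); last by ring.
  by rewrite NNV mul1r -NGz /=; ring.
clearbody x' r.
have wE nu : map_mx (horner_eval z) (w nu) = - N.[z] *: map_mx nu x'.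
  apply/rowP=> i; have /rowP/(_ i) := x'E; rewrite mxE mulr_algl => x'i.
  rewrite !mxE mulNr -[N.[z] * _]linearZ /= x'i !mxE linearN opprK !mulr_algl.
  rewrite /horner_eval !hornerE horner_map_functional !(linearD, linearZ) /=.
  by rewrite !mulr_natl linearMn.
have FE nu : (F nu).[z] = N.[z] ^+ 2 * qform Q (map_mx nu x').
  rewrite -[LHS]/(horner_eval z (F nu)) map_qform wE qformZ sqrrN.
  by congr (_ * qform _ _); apply/matrixP=> i j; rewrite !mxE /= /horner_eval hornerC.
split.
- by rewrite qy /g mulrACA mulrV // mul1r mulrA expr2 [theta * _]mulrA NGz NNV.
- by move: Flz; rewrite FE mulf_eq0 => /norP[].
by move=> qm; move: Fmz; rewrite /Fmu qm FE mulf_eq0 => /norP[].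
Qed.

End GenericReflection.

(** * Linear forms, units and algebraicity in [R[t]/p] *)

Section QuotientByMonic.
Variables (R : idomainType) (n : nat) (p : {poly R}).
Hypotheses (mp : p \is monic) (sp : size p = n.+2).

(** [mk_monic] falls back on a default modulus unless [p] is monic and nonconstant. *)
Lemma mk_monicE : mk_monic p = p.
Proof. by rewrite /mk_monic sp mp. Qed.

Lemma in_qpoly_eq0 f : (in_qpoly p f == 0) = (p %| f).
Proof.
by rewrite -val_eqE /= mk_monicE -Pdiv.IdomainMonic.modpE.
Qed.

Lemma in_qpolyK (s : {poly %/ p}) : in_qpoly p s = s.
Proof. by apply: val_inj; apply: in_qpoly_small; apply: size_mk_monic. Qed.

Lemma val_in_qpoly f : val (in_qpoly p f) = f %% p.
Proof. by rewrite /= mk_monicE Pdiv.IdomainMonic.modpE. Qed.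

Lemma in_qpoly_mod f : in_qpoly p (f %% p) = in_qpoly p f.
Proof. by rewrite -val_in_qpoly in_qpolyK. Qed.

Lemma size_qpoly (s : {poly %/ p}) : (size s <= n.+1)%N.
Proof. by rewrite -ltnS -sp -[in X in (_ < X)%N]mk_monicE size_mk_monic. Qed.

Lemma in_qpolyC a : in_qpoly p a%:P = a%:A.
Proof. by rewrite -alg_polyC linearZ /= rmorph1. Qed.

Lemma dvd_qform_mod m (Q : 'M[R]_m) (v : 'rV[{poly R}]_m) f :
  (p %| qform (map_mx polyC Q) (map_mx (fun g => g %% p) v) - f) =
  (p %| qform (map_mx polyC Q) v - f).
Proof.
rewrite -!in_qpoly_eq0 !rmorphB !map_qform.
suff -> : map_mx (in_qpoly p) (map_mx (fun g => g %% p) v) = map_mx (in_qpoly p) v.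
  by [].
by apply/rowP=> i; rewrite !mxE in_qpoly_mod.
Qed.

Definition qpoly_coef j (s : {poly %/ p}) : R^o := s`_j.

Fact qpoly_coef_is_linear j : linear (qpoly_coef j).
Proof. by move=> a s r; rewrite /qpoly_coef coefD coefZ. Qed.

HB.instance Definition _ j :=
  GRing.isLinear.Build R {poly %/ p} R^o _ (qpoly_coef j) (qpoly_coef_is_linear j).

(** Multiplication by a suitable power of [X] moves the leading coefficient of a nonzero [s] to
    degree [n], just below the degree of [p], so no reduction takes place. *)
Lemma qpoly_coef_lead (s : {poly %/ p}) :
  (forall r, qpoly_coef n (r * s) = 0) -> s = 0.
Proof.
move=> lam0; apply/eqP; rewrite -val_eqE /=; apply/negPn/negP => s0.
have ss := size_qpoly s.
have := lam0 (in_qpoly p 'X^(n.+1 - size s)).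
have szX : size ('X^(n.+1 - size s) * (s : {poly R})) = n.+1.
  by rewrite size_monicM ?monicXn // size_polyXn addSn subnK.
rewrite -{2}[s]in_qpolyK -rmorphM /qpoly_coef in_qpoly_small; last first.
  by rewrite szX mk_monicE sp.
move=> top0; have : lead_coef ('X^(n.+1 - size s) * (s : {poly R})) = 0.
  by rewrite /lead_coef szX.
by move/eqP; rewrite lead_coefM lead_coefXn mul1r lead_coef_eq0 (negPf s0).
Qed.

(** The constant coefficient of [X a] modulo [p] is [- a_n p_0], which reduces the claim to the top
    coefficient. *)
Lemma qpoly_coef_const (s : {poly %/ p}) : p`_0 != 0 ->
  (forall r, qpoly_coef 0 (r * s) = 0) -> s = 0.
Proof.
move=> p0 lam0; apply: qpoly_coef_lead => r.
have := lam0 (in_qpoly p 'X * r); rewrite -mulrA; move: (r * s) => a.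
rewrite -{1}[a]in_qpolyK -in_qpolyM.
pose b : {poly R} := 'X * (a : {poly R}) - (a : {poly R})`_n *: p.
have -> : in_qpoly p ('X * (a : {poly R})) = in_qpoly p b.
  apply/eqP; rewrite -subr_eq0 -rmorphB in_qpoly_eq0 /b opprB addrC addrNK.
  by rewrite -mul_polyC dvdp_mull.
rewrite /qpoly_coef in_qpoly_small.
  rewrite /b coefB coefXM coefZ /= sub0r => /eqP.
  by rewrite oppr_eq0 mulf_eq0 (negPf p0) orbF => /eqP.
rewrite mk_monicE sp ltnS; apply/leq_sizeP => j; rewrite leq_eqVlt.
rewrite /b coefB coefXM coefZ => /predU1P[<-|ltnj] /=.
  by have := monicP mp; rewrite /lead_coef sp /= => ->; rewrite mulr1 subrr.
case: j ltnj => // j ltnj /=.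
rewrite (nth_default 0 (_ : size p <= j.+1)%N) ?sp // mulr0 subr0.
by apply: nth_default; apply: leq_trans (size_qpoly a) _.
Qed.

Lemma in_qpolyX_unit : p`_0 \is a GRing.unit -> exists s, in_qpoly p 'X * s = 1.
Proof.
move=> p0; have [b Dp] : exists b, p = b * 'X + (p`_0)%:P.
  by elim/poly_ind: p => [|c a _]; [exists 0|exists c];
   rewrite ?mul0r ?coef0 ?addr0 // coefD coefMX coefC add0r.
exists (- (p`_0)^-1 *: in_qpoly p b).
rewrite -scalerAr -in_qpolyM mulrC.
have -> : b * 'X = p - (p`_0)%:P by rewrite {1}Dp addrK.
have /eqP p_eq0 : in_qpoly p p == 0 by rewrite in_qpoly_eq0.
by rewrite rmorphB /= p_eq0 sub0r in_qpolyC scalerN scaleNr opprK scalerA mulVr ?scale1r.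
Qed.

Lemma qpoly_algebraic (s : {poly %/ p}) :
  exists2 chi, chi \is monic & root (map_poly (in_alg {poly %/ p}) chi) s.
Proof.
have [C [_ dvd_chi]] := char_poly_mod s mp sp.
exists (char_poly (horner_mx C s)); first exact: char_poly_monic.
move: dvd_chi; rewrite -in_qpoly_eq0 /comp_poly -horner_map /= in_qpolyK.
rewrite -map_poly_comp; congr (_.[_] == 0); apply: eq_map_poly => a /=.
by rewrite in_qpolyC.
Qed.

End QuotientByMonic.

Lemma lift_poly (R : nzRingType) (k : nzRingType) (pi : {rmorphism R -> k}) :
  (forall a, exists b, pi b = a) ->
  forall f : {poly k}, exists g : {poly R}, map_poly pi g = f.
Proof.
move=> pi_surj; elim/poly_ind => [|f a [g <-]]; first by exists 0; rewrite rmorph0.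
have [b <-] := pi_surj a.
by exists (g * 'X + b%:P); rewrite rmorphD rmorphM /= map_polyX map_polyC.
Qed.

Definition coef_row (R : nzRingType) m j (v : 'rV[{poly R}]_m) : 'rV[R]_m :=
  \row_i (v 0 i)`_j.

(** * Lifting reflections from the residue field to [R[t]/p] *)

Section ReflectionLift.
Variables (R : idomainType) (k : fieldType) (pi : {rmorphism R -> k}).
Hypotheses (pi_surj : forall a, exists b, pi b = a)
  (pi_unit : forall a, (pi a != 0) = (a \is a GRing.unit))
  (char0 : residue_char0 R).
Variables (m : nat) (Q : 'M[R]_m.+2) (n : nat) (p : {poly R}).
Hypotheses (regQ : regular_qform Q) (mp : p \is monic) (sp : size p = n.+2)
  (p0 : p`_0 \is a GRing.unit).

Local Notation QP := (map_mx polyC Q).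
Local Notation pk := (map_poly pi p).
Local Notation red := (in_qpoly pk \o map_poly pi).

Let mpk : pk \is monic. Proof. exact: monic_map. Qed.

Let spk : size pk = n.+2.
Proof. by rewrite size_map_poly_id0 ?(monicP mp) ?rmorph1 ?oner_eq0. Qed.

Let char0k i : i.+1%:R != 0 :> k.
Proof. by rewrite -(rmorph_nat pi) pi_unit char0. Qed.

Let regQk : regular_qform (map_mx pi Q).
Proof.
by rewrite /regular_qform map_trmx -map_mxD det_map_mx unitfE pi_unit.
Qed.

Let redC : map_mx red QP = map_mx (in_alg {poly %/ pk}) (map_mx pi Q).
Proof.
by apply/matrixP=> i j; rewrite !mxE /= map_polyC /= in_qpolyC.
Qed.

Let red_dvd f : p %| f -> red f = 0.
Proof.
move=> /(monic_dvdP _ mp)[g ->] /=; rewrite rmorphM /=; apply/eqP.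
by rewrite (in_qpoly_eq0 mpk spk) dvdp_mull.
Qed.

(** [generic_reflection] provides the reflection over the residue field, with the coefficients of
    degrees [j] and [j'] as linear forms. Its vector is lifted arbitrarily and the inverse of its
    value by [inverse_mod_lift]; the map to the residue field detects the units. *)
Lemma reflection_lift j j' (v : 'rV[{poly R}]_m.+2) :
  j = 0%N \/ j = n -> p %| qform QP v - 'X ->
  (forall i, (size (v 0 i)%R <= n.+1)%N) ->
  exists v' : 'rV[{poly R}]_m.+2,
    [/\ p %| qform QP v' - 'X, forall i, (size (v' 0 i)%R <= n.+1)%N,
        qform Q (coef_row j v') \is a GRing.unit &
        qform Q (coef_row j' v) \is a GRing.unit ->
        qform Q (coef_row j' v') \is a GRing.unit].
Proof.
move=> j0n qv sv; pose x := map_mx red v.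
have qx : qform (map_mx (in_alg {poly %/ pk}) (map_mx pi Q)) x = in_qpoly pk 'X.
  rewrite -redC -map_qform; have := red_dvd qv.
  by rewrite rmorphB => /eqP; rewrite subr_eq0 => /eqP ->; rewrite /= map_polyX.
have pk0 : pk`_0 != 0 by rewrite coef_map pi_unit.
(* The value of [x] is the class of [t], invertible because [p(0)] is a unit. *)
have qx_unit : qform (map_mx (in_alg {poly %/ pk}) (map_mx pi Q)) x \is a GRing.unit.
  have [|s Xs] := in_qpolyX_unit mpk spk; first by rewrite unitfE.
  by rewrite qx; apply/unitrPr; exists s.
have lam_nd : nondegenerate_functional (@qpoly_coef k pk j).
  case: j0n => -> s; [exact: (qpoly_coef_const mpk spk)|exact: (qpoly_coef_lead mpk spk)].
have [y [g [qyg lamx' mux']]] := generic_reflection char0k regQk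
  (qpoly_algebraic mpk spk) (@qpoly_coef k pk j') qx_unit lam_nd.
have [Y0 Y0E] : exists Y : 'I_m.+2 -> {poly R}, forall i, map_poly pi (Y i) = y 0 i.
  by apply: (fin_all_exists (P := fun i f => map_poly pi f = y 0 i)) => i; apply: lift_poly.
pose Y : 'rV[{poly R}]_m.+2 := \row_i Y0 i.
have redY : map_mx red Y = y.
  by apply/rowP=> i; rewrite !mxE /= Y0E in_qpolyK.
have qY : red (qform QP Y) * g = 1 by rewrite map_qform redC redY.
have [|h qYh] := @inverse_mod_lift R k pi n p (qform QP Y) g pi_unit mp sp.
  rewrite -(in_qpoly_eq0 mpk spk) rmorphB rmorphM /= in_qpolyK.
  by rewrite -[in_qpoly _ (map_poly _ _)]/(red _) qY rmorph1 subrr.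
have redh : red h = g.
  have := red_dvd qYh; rewrite rmorphB rmorphM rmorph1 => /eqP.
  rewrite subr_eq0 => /eqP qh1.
  by rewrite -[LHS]mul1r -qY mulrAC qh1 mul1r.
pose V := v - (polar QP v Y * h) *: Y.
have redV : map_mx red V = x - (polar (map_mx (in_alg {poly %/ pk}) (map_mx pi Q)) x y * g) *: y.
  rewrite -redh -redY -redC -map_polar -rmorphM.
  by apply/rowP=> i; rewrite !mxE -rmorphM -rmorphB.
pose v' := map_mx (fun f => f %% p) V.
have sv' i : (size (v' 0 i)%R <= n.+1)%N.
  by rewrite mxE -ltnS -sp ltn_modp monic_neq0.
have coefE (u : 'rV[{poly R}]_m.+2) i0 : (forall i, (size (u 0 i)%R <= n.+1)%N) ->
    map_mx (@qpoly_coef k pk i0) (map_mx red u) = map_mx pi (coef_row i0 u).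
  move=> su; apply/rowP=> i; rewrite !mxE /qpoly_coef in_qpoly_small ?coef_map //.
  by rewrite (mk_monicE mpk spk) spk ltnS (leq_trans (size_poly _ _)).
have redv' : map_mx red v' = map_mx red V.
  apply/rowP=> i; rewrite [LHS]mxE [RHS]mxE [v' 0 i]mxE; apply/eqP.
  rewrite -subr_eq0 -rmorphB.
  apply/eqP; apply: red_dvd; rewrite -dvdpNr opprB.
  by rewrite {1}(Pdiv.IdomainMonic.divp_eq mp (V 0 i)) addrK dvdp_mull.
have qV : p %| qform QP V - 'X.
  (* [h] inverts [q(Y)] only modulo [p], so the lifted reflection preserves the value up to this
     multiple of [q(Y) h - 1]. *)
  have -> : qform QP V - 'X = (qform QP v - 'X) +
      polar QP v Y ^+ 2 * h * (qform QP Y * h - 1).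
    by rewrite /V -scaleNr qformD qformZ polarZr; ring.
  by rewrite dvdp_add // dvdp_mull.
have unitE (u : 'rV[{poly R}]_m.+2) i0 : (forall i, (size (u 0 i)%R <= n.+1)%N) ->
    (qform Q (coef_row i0 u) \is a GRing.unit) =
    (qform (map_mx pi Q) (map_mx (@qpoly_coef k pk i0) (map_mx red u)) != 0).
  by move=> su; rewrite coefE // -map_qform pi_unit.
exists v'; split=> //.
- by rewrite (dvd_qform_mod mp sp).
- by rewrite unitE // redv' redV.
by rewrite !unitE // redv' redV.
Qed.
End ReflectionLift.

(** * Descent on the degree *)

Section ValueGroup.
Variables (T : comUnitRingType) (m : nat) (Q : 'M[T]_m).

Lemma Dq_unit a : Dq Q a -> a \is a GRing.unit.
Proof.
by elim=> [|x y _ ux _ uy|x y _ ux _ uy]; rewrite ?unitr1 // unitrM ?unitrV ux.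
Qed.

Lemma DqM a b : Dq Q a -> Dq Q b -> Dq Q (a * b).
Proof.
move=> Da Db; elim: Da => [|x y qx ux _ IH|x y qx ux _ IH]; first by rewrite mul1r.
  by rewrite -mulrA; apply: gen_unitsM.
by rewrite -mulrA; apply: gen_unitsV.
Qed.

Lemma DqV a : Dq Q a -> Dq Q a^-1.
Proof.
elim=> [|x y qx ux Dy IH|x y qx ux Dy IH]; first by rewrite invr1; apply: gen_units1.
  by rewrite invrM ?(Dq_unit Dy) // mulrC; apply: gen_unitsV.
by rewrite invrM ?unitrV ?(Dq_unit Dy) // invrK mulrC; apply: gen_unitsM.
Qed.

Lemma Dq_value x : qform Q x \is a GRing.unit -> Dq Q (qform Q x).
Proof.
by move=> ux; rewrite -[qform Q x]mulr1; apply: gen_unitsM => //; [exists x|apply: gen_units1].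
Qed.

Lemma DqX a n : Dq Q a -> Dq Q (a ^+ n).
Proof.
move=> Da; elim: n => [|n IH]; first exact: gen_units1.
by rewrite exprS; apply: DqM.
Qed.

End ValueGroup.

Lemma coefM_top (R : nzRingType) n (f g : {poly R}) :
  (size f <= n.+1)%N -> (size g <= n.+1)%N -> (f * g)`_(n + n) = f`_n * g`_n.
Proof.
move=> sf sg; have ltn : (n < (n + n).+1)%N by rewrite ltnS leq_addr.
rewrite coefM (bigD1 (Ordinal ltn)) //= addnK big1 ?addr0 // => i ni.
have : (i : nat) != n by rewrite -[n]/(val (Ordinal ltn)) val_eqE.
rewrite neq_ltn => /orP[lt_in|lt_ni].
  rewrite [g`_ _]nth_default ?mulr0 // (leq_trans sg) //.
  by rewrite ltn_subRL ltn_add2r.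
by rewrite [f`_ _]nth_default ?mul0r // (leq_trans sf).
Qed.

Section QformPoly.
Variables (R : comNzRingType) (m : nat) (Q : 'M[R]_m) (n : nat) (v : 'rV[{poly R}]_m).
Hypothesis sv : forall i, (size (v 0 i)%R <= n.+1)%N.

Let u j := \sum_i v 0 i * (Q i j)%:P.

Let qE : qform (map_mx polyC Q) v = \sum_j u j * v 0 j.
Proof.
rewrite /qform mxE; apply: eq_bigr => j _; rewrite !mxE; congr (_ * _).
by apply: eq_bigr => i _; rewrite mxE.
Qed.

Let su j : (size (u j) <= n.+1)%N.
Proof.
apply: leq_trans (size_sum _ _ _) _; apply/bigmax_leqP => i _.
by rewrite mulrC mul_polyC (leq_trans (size_scale_leq _ _)).
Qed.

Lemma qform_poly_top :
  (qform (map_mx polyC Q) v)`_(n + n) = qform Q (coef_row n v).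
Proof.
rewrite qE coef_sum /qform mxE; apply: eq_bigr => j _.
rewrite coefM_top // !mxE coef_sum; congr (_ * _).
by apply: eq_bigr => i _; rewrite coefMC mxE.
Qed.

Lemma size_qform_poly : (size (qform (map_mx polyC Q) v) <= (n + n).+1)%N.
Proof.
rewrite qE; apply: leq_trans (size_sum _ _ _) _; apply/bigmax_leqP => j _.
apply: leq_trans (size_polyMleq _ _) _.
have := leq_add (su j) (sv j); rewrite addSn addnS.
by case: (_ + _)%N.
Qed.

End QformPoly.

Lemma horner_qform (R : comNzRingType) m (Q : 'M[R]_m) (v : 'rV[{poly R}]_m) a :
  (qform (map_mx polyC Q) v).[a] = qform Q (map_mx (horner_eval a) v).
Proof.
rewrite -[LHS]/(horner_eval a _) map_qform; congr (qform _ _).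
by apply/matrixP=> i j; rewrite !mxE /= /horner_eval hornerC.
Qed.

Section Descent.
Variables (R : idomainType) (m : nat) (Q : 'M[R]_m.+2).
Hypotheses (locR : local_ring R) (char0 : residue_char0 R) (regQ : regular_qform Q).

(** [(-1)^d p(0)] is the norm of [t] from [R[t]/p]. The induction trades [p] for the monic multiple
    of the cofactor [h] in [q(v) - X = h p], of degree [d - 2]. *)
Lemma norm_descent d (p : {poly R}) (v : 'rV[{poly R}]_m.+2) :
  p \is monic -> size p = d.+1 -> p`_0 \is a GRing.unit ->
  p %| qform (map_mx polyC Q) v - 'X -> Dq Q ((-1) ^+ d * p`_0).
Proof.
have [k [pi [pi_surj pi_unit]]] := residue_field_exists locR.
have [b] := ubnP d; elim: b d p v => // b IHb [|[|n]] p v ltd mp sp p0 qv.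
- have -> : p = 1.
    have /size1_polyC Dp : (size p <= 1)%N by rewrite sp.
    by move: mp; rewrite Dp monicE lead_coefC => /eqP ->.
  by rewrite expr0 mul1r coef1; apply: gen_units1.
(* Degree 1: evaluation at the root [- p_0] of [p] shows that [- p_0] is itself a value of [q]. *)
- have p1 : p`_1 = 1 by have := monicP mp; rewrite /lead_coef sp.
  have pa : p.[- p`_0] = 0.
    by rewrite horner_coef sp !big_ord_recl big_ord0 /= /bump /= p1; ring.
  move: qv => /(monic_dvdP _ mp)[g] /(congr1 (horner^~ (- p`_0))).
  rewrite hornerM pa mulr0 hornerD hornerN hornerX horner_qform opprK => /eqP.
  rewrite addr_eq0 => /eqP qa; rewrite expr1 mulN1r -qa; apply: Dq_value.
  by rewrite qa unitrN.
(* The first reflection makes the value at the top coefficients a unit; the second does so for the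
   constant coefficients and keeps the first gain. *)
have [||v1 [qv1 sv1 top1 _]] := reflection_lift pi_surj pi_unit char0 regQ mp sp p0
  (v := map_mx (fun f => f %% p) v) n.+1 (or_intror (erefl n.+1)).
- by rewrite (dvd_qform_mod mp sp).
- by move=> i; rewrite mxE -ltnS -sp ltn_modp monic_neq0.
have [v2 [qv2 sv2 const2 top2]] := reflection_lift pi_surj pi_unit char0 regQ mp sp p0
  n.+1 (or_introl (erefl 0%N)) qv1 sv1.
have {}top2 := top2 top1.
set F := qform _ v2 in qv2; set c := qform Q (coef_row n.+1 v2) in top2.
(* [F] has degree [2 (n + 1)], at least 2, so subtracting [X] leaves its leading coefficient [c]
   unchanged. *)
have ltX : (size ('X : {poly R}) < (n.+1 + n.+1).+1)%N.
  by rewrite size_polyX addnS.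
have Ftop : (F - 'X)`_(n.+1 + n.+1) = c.
  by rewrite coefB [('X)`_ _]nth_default ?subr0 // qform_poly_top.
have c0 : c != 0 by apply: contraTneq top2 => ->; rewrite unitr0.
have sF : size (F - 'X) = (n.+1 + n.+1).+1.
  apply/eqP; rewrite eqn_leq; apply/andP; split.
    apply: leq_trans (size_polyD _ _) _; rewrite geq_max size_polyN size_qform_poly //=.
    exact: ltnW.
  by rewrite ltnNge; apply: contraNN c0 => le; rewrite -Ftop nth_default.
have [h Dh] := monic_dvdP _ mp qv2.
have sh : size h = n.+1.
  have := sF; rewrite Dh size_Mmonic //; last first.
    by apply: contraNneq c0 => h0; rewrite -Ftop Dh h0 mul0r coef0.
  by rewrite sp addnS -[RHS]addnS => /addIn.
have lh : lead_coef h = c.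
  by rewrite -Ftop -[(n.+1 + n.+1)%N]/((n.+1 + n.+1).+1.-1) -sF -/(lead_coef _) Dh lead_coef_Mmonic.
have h0p0 : h`_0 * p`_0 = qform Q (coef_row 0 v2).
  rewrite -coef0M -Dh coefB coefX subr0 -horner_coef0 horner_qform.
  congr (qform _ _); apply/rowP=> i.
  by rewrite !mxE /horner_eval horner_coef0.
have /andP[h0 _] : (h`_0 \is a GRing.unit) && (p`_0 \is a GRing.unit).
  by rewrite -unitrM h0p0.
have cV0 : c^-1 != 0 by rewrite invr_eq0.
(* The same vector [v2] serves for [h / c], which also divides [q(v2) - X]. *)
have := IHb n (c^-1 *: h) v2; rewrite coefZ size_scale // sh.
have hE : h = c%:P * (c^-1 *: h) by rewrite mul_polyC scalerA mulrV ?scale1r.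
have mh : c^-1 *: h \is monic by rewrite monicE lead_coefZ lh mulVr.
move/(_ (ltnW (ltd : (n.+1 < b)%N)) mh erefl); set E := (-1) ^+ n * _ => DE.
have {}DE : Dq Q E.
  apply: DE; first by rewrite unitrM unitrV top2.
  by rewrite -/F Dh {2}hE mulrAC dvdp_mull.
(* [E] is the norm [(-1)^n h(0) / c] given by the induction; with [h(0) p(0) = q(v2(0))] it
   determines [p(0)]. *)
suff -> : (-1) ^+ n.+2 * p`_0 = qform Q (coef_row 0 v2) * c^-1 * E^-1.
  by apply: DqM; [apply: DqM; [apply: Dq_value|apply: DqV; apply: Dq_value]|apply: DqV].
apply: (canRL (mulrK (Dq_unit DE))).
by rewrite -h0p0 /E !exprS !mulN1r opprK mulrACA -expr2 sqrr_sign; ring.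
Qed.
End Descent.

(** * Primitive elements and norms *)

(* If [g] is injective on the roots and unramified there, then each factor
   [g - b] absorbs at most one root, so [h o g] vanishes on all of them only
   if [h] has as many factors. *)
Lemma size_annihilator (L : fieldType) (g h : {poly L}) (rs : seq L) :
  {in rs &, forall a b, a != b -> g.[a] != g.[b]} ->
  {in rs, forall a, g^`().[a] != 0} ->
  \prod_(a <- rs) ('X - a%:P) %| h \Po g -> h != 0 -> (size rs < size h)%N.
Proof.
elim: rs h => [|a rs IHrs] h g_inj g_unr; first by rewrite size_poly_gt0.
rewrite big_cons => dvd_h h0.
have /factor_theorem[h1 Dh] : root h g.[a].
  by rewrite /root -horner_comp -/(root _ a) root_factor_theorem (dvdp_trans _ dvd_h) // dvdp_mulr.
have /factor_theorem[G DG] : root (g - g.[a]%:P) a.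
  by rewrite /root !hornerE subrr.
have Ga b : b \in a :: rs -> G.[b] != 0.
  move=> rs_b; have [->|ba] := eqVneq b a.
    have := g_unr a (mem_head _ _); have := congr1 (fun f => f^`().[a]) DG.
    rewrite /= derivB derivC subr0 derivM derivXsubC !hornerE subrr mulr0 add0r.
    by move=> ->.
  have := g_inj b a rs_b (mem_head _ _) ba; rewrite -subr_eq0.
  have -> : g.[b] - g.[a] = (g - g.[a]%:P).[b] by rewrite !hornerE.
  by rewrite DG hornerM mulf_eq0 => /norP[].
have h1_0 : h1 != 0 by apply: contraNneq h0 => h10; rewrite Dh h10 mul0r.
rewrite Dh size_mul ?polyXsubC_eq0 // size_XsubC addn2 /= ltnS.
apply: IHrs => //.
- by move=> b1 b2 rb1 rb2; apply: g_inj; rewrite inE ?rb1 ?rb2 orbT.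
- by move=> b rb; apply: g_unr; rewrite inE rb orbT.
move: dvd_h; rewrite Dh comp_polyM comp_polyB comp_polyX comp_polyC DG.
rewrite mulrA mulrC dvdp_mul2r ?polyXsubC_eq0 // Gauss_dvdpl //.
rewrite coprimep_sym big_seq; elim/big_rec: _ => [|b q rb cq]; first exact: coprimep1.
by rewrite coprimepMr cq andbT coprimep_XsubC /root Ga // inE rb orbT.
Qed.

(** As polynomials in the shift, [D a b] is [g(a) - g(b)] and [E a] is [g'(a)]. Setting the shift to
    [-a] shows that [D a b], and the cofactor of [X + a] in [E a], are nonzero; an integer outside
    the roots of all of them and of [P] is chosen. *)
Lemma separating_shift (L : fieldType) (s : {poly L}) (rs : seq L) (P : {poly L}) :
  (forall n, n.+1%:R != 0 :> L) -> {in rs, forall a, s.[a] != 0} -> P != 0 ->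
  exists z : nat, let g := s * ('X + z%:R%:P) ^+ 2 in
    [/\ {in rs &, forall a b, a != b -> g.[a] != g.[b]},
        {in rs, forall a, g^`().[a] != 0} & P.[z%:R] != 0].
Proof.
move=> char0 s_rs P0.
(* The value 1 on the diagonal lets the product run over all pairs of roots. *)
pose D a b : {poly L} := if a == b then 1 else
  s.[a] *: ('X + a%:P) ^+ 2 - s.[b] *: ('X + b%:P) ^+ 2.
pose E a : {poly L} := (s^`().[a] *: ('X + a%:P) + (2 * s.[a])%:P) * ('X + a%:P).
have D0 a b : a \in rs -> b \in rs -> D a b != 0.
  rewrite /D => ra rb; case: (eqVneq a b) => [_|nab]; first by rewrite oner_eq0.
  apply/eqP => /(congr1 (horner^~ (- a))); rewrite !hornerE /= addNr.
  rewrite ?mulr0 ?mul0r sub0r => /eqP; rewrite oppr_eq0 !mulf_eq0 (negPf (s_rs b rb)) /=.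
  by rewrite orbb addrC subr_eq0 eq_sym (negPf nab).
have Xa a : 'X + a%:P != 0 :> {poly L} by rewrite -[a]opprK polyCN polyXsubC_eq0.
have E0 a : a \in rs -> E a != 0.
  move=> ra; rewrite mulf_neq0 //; apply/eqP => /(congr1 (horner^~ (- a))).
  rewrite !hornerE /= addNr mulr0 add0r => /eqP.
  by rewrite mulf_eq0 (negPf (char0 1%N)) (negPf (s_rs a ra)).
pose T := P * \prod_(a <- rs) (E a * \prod_(b <- rs) D a b).
have [|z] := @nat_nonroot _ T char0.
  rewrite mulf_neq0 // prodf_seq_neq0; apply/allP => a ra /=.
  by rewrite mulf_neq0 ?E0 // prodf_seq_neq0; apply/allP => b rb /=; apply: D0.
rewrite hornerM mulf_eq0 negb_or horner_prod prodf_seq_neq0 => /andP[Pz /allP Tz].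
exists z; split=> // [a b ra rb nab|a ra].
  have := Tz a ra; rewrite /= hornerM mulf_eq0 negb_or horner_prod prodf_seq_neq0.
  move=> /andP[_ /allP/(_ b rb)] /=; rewrite /D (negPf nab) => Dz.
  rewrite -subr_eq0; move: Dz; congr (_ != 0); rewrite !hornerE /=; ring.
have := Tz a ra; rewrite /= hornerM mulf_eq0 negb_or => /andP[Ez _].
move: Ez; congr (_ != 0); rewrite !derivE /E !hornerE /=; ring.
Qed.

(** * Multiplication matrices of a simple extension *)

Section SimpleExtension.
Variables (R : idomainType) (S : comUnitRingType) (f : {rmorphism R -> S}).
Variables (n : nat) (c : S).
Hypothesis ext : simple_extension f n.+1 c.

Let gen s : exists a : 'I_n.+1 -> R, s = \sum_(i < n.+1) f (a i) * c ^+ i.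
Proof. by case: ext. Qed.

Let free (a b : 'I_n.+1 -> R) :
  \sum_(i < n.+1) f (a i) * c ^+ i = \sum_(i < n.+1) f (b i) * c ^+ i -> a =1 b.
Proof.
case: ext => _ _ free0 /eqP; rewrite -subr_eq0 -sumrB => /eqP ab0 i.
apply/eqP; rewrite -subr_eq0; apply/eqP; apply: (free0 (fun i => a i - b i)).
by rewrite -[RHS]ab0; apply: eq_bigr => j _; rewrite rmorphB mulrBl.
Qed.

Lemma mul_matrix_exists s : exists A : 'M[R]_n.+1, mul_matrix f c s A.
Proof.
have [A AE] : exists A : 'I_n.+1 -> 'I_n.+1 -> R,
    forall j : 'I_n.+1, s * c ^+ j = \sum_(i < n.+1) f (A j i) * c ^+ i.
  by apply: (fin_all_exists (P := fun (j : 'I_n.+1) a => s * c ^+ j = \sum_(i < n.+1) f (a i) * c ^+ i)) => j; apply: gen.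
by exists (\matrix_(i, j) A j i) => j; rewrite AE; apply: eq_bigr => i _; rewrite mxE.
Qed.

Lemma mul_matrix_inj s (A B : 'M[R]_n.+1) :
  mul_matrix f c s A -> mul_matrix f c s B -> A = B.
Proof.
move=> sA sB; apply/matrixP=> i j.
by apply: (free (a := A^~ j) (b := B^~ j)); rewrite -sA -sB.
Qed.

Lemma mul_matrixD s t (A B : 'M[R]_n.+1) :
  mul_matrix f c s A -> mul_matrix f c t B -> mul_matrix f c (s + t) (A + B).
Proof.
move=> sA tB j; rewrite mulrDl sA tB -big_split; apply: eq_bigr => i _ /=.
by rewrite mxE rmorphD mulrDl.
Qed.

Lemma mul_matrixC a : mul_matrix f c (f a) (a%:M : 'M[R]_n.+1).
Proof.
move=> j; rewrite (bigD1 j) //= mxE eqxx mulr1n big1 ?addr0 // => i ij.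
by rewrite mxE (negPf ij) mulr0n rmorph0 mul0r.
Qed.

Lemma mul_matrixM s t (A B : 'M[R]_n.+1) :
  mul_matrix f c s A -> mul_matrix f c t B -> mul_matrix f c (s * t) (A *m B).
Proof.
move=> sA tB j; rewrite -mulrA tB mulr_sumr.
under eq_bigr => i _ do rewrite mulrCA sA mulr_sumr.
rewrite exchange_big; apply: eq_bigr => i _ /=; rewrite mxE rmorph_sum mulr_suml.
by apply: eq_bigr => l _; rewrite rmorphM mulrA [f (B _ _) * _]mulrC.
Qed.

Lemma mul_matrix_horner s (A : 'M[R]_n.+1) (h : {poly R}) :
  mul_matrix f c s A -> mul_matrix f c (map_poly f h).[s] (horner_mx A h).
Proof.
move=> sA; elim/poly_ind: h => [|h a IHh].
  by rewrite !rmorph0 horner0 -(rmorph0 f) -[0 : 'M_n.+1](raddf0 (@scalar_mx R n.+1)); apply: mul_matrixC.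
rewrite !rmorphD !rmorphM /= map_polyX map_polyC hornerMXaddC horner_mx_X horner_mx_C.
by apply: mul_matrixD (mul_matrixC a); apply: mul_matrixM.
Qed.

Lemma mul_matrix_col0 s (A : 'M[R]_n.+1) :
  mul_matrix f c s A -> s = \sum_(i < n.+1) f (A i 0) * c ^+ i.
Proof. by move=> sA; rewrite -sA mulr1. Qed.

Lemma krylov_generator (C : 'M[R]_n.+1) : mul_matrix f c c C -> krylov C = 1%:M.
Proof.
move=> cC; apply/matrixP=> i j; rewrite mxE.
have := mul_matrix_horner 'X^j cC.
rewrite map_polyXn hornerXn rmorphXn /= horner_mx_X => /mul_matrix_col0 cj.
apply: (free (a := fun i => (C ^+ j) i 0) (b := fun i => 1%:M i j)).
by rewrite -cj -[LHS]mul1r -(rmorph1 f) (mul_matrixC 1).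
Qed.

Lemma poly_generator s : exists g : {poly R}, s = (map_poly f g).[c].
Proof.
have [a ->] := gen s; exists (\sum_(i < n.+1) a i *: 'X^i).
rewrite rmorph_sum /= horner_sum; apply: eq_bigr => i _.
by rewrite map_polyZ map_polyXn hornerZ hornerXn.
Qed.

(** The columns of [krylov A] are the coordinates of the powers of [s], so solving a linear system
    writes [t] as a combination of these powers. *)
Lemma krylov_primitive s (A : 'M[R]_n.+1) t :
  mul_matrix f c s A -> krylov A \in unitmx ->
  exists v : {poly R}, t = (map_poly f v).[s].
Proof.
move=> sA unitK; have [a ->] := gen t.
pose w := invmx (krylov A) *m \col_i a i.
exists (rVpoly w^T); rewrite (mul_matrix_col0 (mul_matrix_horner _ sA)).
apply: eq_bigr => i _; congr (f _ * _).
have := krylov_horner A w^T; rewrite trmxK mulKVmx // => /colP/(_ i).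
by rewrite !mxE.
Qed.

Lemma mul_matrix0 (A : 'M[R]_n.+1) : mul_matrix f c 0 A -> A = 0.
Proof.
move=> A0; apply: mul_matrix_inj A0 _; have := mul_matrixC 0.
by rewrite rmorph0 -scalemx1 scale0r.
Qed.

Lemma norm_unit s (A : 'M[R]_n.+1) :
  s \is a GRing.unit -> mul_matrix f c s A -> \det A \is a GRing.unit.
Proof.
move=> us sA; have [B sB] := mul_matrix_exists s^-1.
have := mul_matrixM sA sB; rewrite mulrV // -(rmorph1 f) => AB.
apply/unitrPr; exists (\det B).
by rewrite -det_mulmx (mul_matrix_inj AB (mul_matrixC 1)) det1.
Qed.

End SimpleExtension.

(** * Norms of single values of the form *)

Section NormOfValue.
Variables (R : idomainType) (S : comUnitRingType) (f : {rmorphism R -> S}).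
Variables (n : nat) (c : S).
Hypotheses (ext : simple_extension f n.+1 c) (locR : local_ring R)
  (char0 : residue_char0 R).

(** Over a splitting field of the reduced characteristic polynomial of [c], the twisted element is
    given by [s(X) (X + z)^2]. A generic [z] makes this separate the roots with nonzero derivative
    there, and by [size_annihilator] its first [n + 1] powers are then independent. *)
Lemma primitive_twist s : s \is a GRing.unit ->
  exists (z : nat) (A B : 'M[R]_n.+1),
    [/\ mul_matrix f c (s * (c + z%:R) ^+ 2) A, krylov A \in unitmx,
        mul_matrix f c (c + z%:R) B & \det B \is a GRing.unit].
Proof.
move=> us; have [C cC] := mul_matrix_exists ext c.
have [g0 sE] := poly_generator ext s; have [g1 sVE] := poly_generator ext s^-1.
have [k [pi [_ pi_unit]]] := residue_field_exists locR.
have [L [io [rs rsE]]] := splitting_field_exists (monic_map pi (char_poly_monic C)).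
pose phi : {rmorphism R -> L} := io \o pi.
have phi_unit a : (phi a != 0) = (a \is a GRing.unit).
  by rewrite /= fmorph_eq0 pi_unit.
have char0L i : i.+1%:R != 0 :> L by rewrite -(rmorph_nat phi) phi_unit char0.
have {}rsE : char_poly (map_mx phi C) = \prod_(a <- rs) ('X - a%:P).
  by rewrite -rsE -map_char_poly -map_poly_comp.
have krCL : krylov (map_mx phi C) = 1%:M.
  by rewrite map_krylov (krylov_generator ext cC) map_mx1.
have srs : size rs = n.+1.
  have := size_char_poly (map_mx phi C); rewrite rsE size_prod_XsubC.
  by case.
(* [s] has an inverse, so the polynomial representing it cannot vanish at a root. *)
have s_rs : {in rs, forall a, (map_poly phi g0).[a] != 0}.
  move=> a ra; have gg0 : horner_mx C (g0 * g1 - 1) = 0.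
    apply: (mul_matrix0 ext).
    have := mul_matrix_horner (g0 * g1 - 1) cC.
    by rewrite rmorphB rmorphM /= !hornerE -sE -sVE mulrV // rmorph1 hornerC subrr.
  have : char_poly (map_mx phi C) %| map_poly phi (g0 * g1 - 1).
    apply: char_poly_dvd_krylov; first by rewrite krCL unitmx1.
    by rewrite -map_horner_mx gg0 map_mx0 linear0.
  rewrite rsE => /dvdpP[b bE]; have := congr1 (horner^~ a) bE.
  rewrite hornerM horner_prod (big_rem a ra) /= hornerXsubC subrr mul0r mulr0.
  rewrite rmorphB rmorphM rmorph1 /= !hornerE => /eqP; rewrite subr_eq0.
  by apply: contraTneq => ->; rewrite mul0r eq_sym oner_eq0.
(* [P] is the image of [det(X + C)], so a shift [z] that is not a root of it makes the norm of
   [c + z] a unit. *)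
pose P := map_poly phi (char_poly (- C)).
have [|z [g_inj g_unr Pz]] := separating_shift char0L s_rs (P := P).
  by rewrite monic_neq0 // monic_map // char_poly_monic.
have [B cB] := mul_matrix_exists ext (c + z%:R).
have BE : B = C + z%:R%:M.
  apply: (mul_matrix_inj ext cB); rewrite -(rmorph_nat f).
  by apply: mul_matrixD; [|apply: mul_matrixC].
have [A sA] := mul_matrix_exists ext (s * (c + z%:R) ^+ 2).
exists z, A, B; split=> //; last first.
  move: Pz; rewrite /P -(rmorph_nat phi) horner_map phi_unit.
  suff -> : (char_poly (- C)).[z%:R] = \det B by [].
  rewrite -[LHS]/(horner_eval _ _) /char_poly -det_map_mx BE; congr (\det _).
  apply/matrixP=> i j; rewrite !mxE /= /horner_eval !hornerE hornerMn hornerX.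
  by rewrite opprK addrC.
pose gR := g0 * ('X + z%:R%:P) ^+ 2.
have AE : A = horner_mx C gR.
  apply: (mul_matrix_inj ext sA); have := mul_matrix_horner gR cC.
  rewrite rmorphM rmorphXn rmorphD /= map_polyX map_polyC /= rmorph_nat.
  by rewrite !hornerE -sE.
(* A kernel vector of [krylov A] over [L] would be a nonzero polynomial of degree at most [n]
   annihilating the twisted element, contrary to the number [n + 1] of roots counted with
   multiplicity. *)
rewrite unitmxE -phi_unit -det_map_mx -map_krylov; apply/negP.
move=> /eqP; rewrite -det_tr => /eqP/det0P[w w0 wK].
have : (size rs < size (rVpoly w))%N.
  apply: (size_annihilator g_inj g_unr).
    rewrite -rsE; apply: char_poly_dvd_krylov; first by rewrite krCL unitmx1.
    have -> : map_poly phi g0 * ('X + z%:R%:P) ^+ 2 = map_poly phi gR.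
      by rewrite rmorphM rmorphXn rmorphD /= map_polyX map_polyC /= !rmorph_nat.
    rewrite horner_mx_comp -map_horner_mx -AE krylov_horner -[krylov _]trmxK.
    by rewrite -trmx_mul wK trmx0.
  by apply: contraNneq w0 => w0; rewrite -[w]rVpolyK w0 linear0.
by rewrite srs ltnNge size_poly.
Qed.

(** [a^2 = q(a y) / q(y)] for any [y] with [q(y)] a unit. Such a [y] exists, since otherwise the
    polar form would vanish over the residue field, against regularity. *)
Lemma Dq_square m (Q : 'M[R]_m.+1) a :
  regular_qform Q -> a \is a GRing.unit -> Dq Q (a ^+ 2).
Proof.
move=> regQ ua.
suff [y uy] : exists y, qform Q y \is a GRing.unit.
  have -> : a ^+ 2 = qform Q (a *: y) * (qform Q y)^-1 by rewrite qformZ mulrK.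
  apply: DqM; last exact/DqV/Dq_value.
  by apply: Dq_value; rewrite qformZ unitrM unitrX.
apply: NNPP => noy.
have [k [pi [_ pi_unit]]] := residue_field_exists locR.
have q0 y : pi (qform Q y) = 0.
  by apply/eqP/negPn/negP; rewrite pi_unit => uy; apply: noy; exists y.
move: regQ; rewrite /regular_qform -pi_unit -det_map_mx.
have -> : map_mx pi (Q + Q^T) = 0.
  apply/matrixP=> i j; rewrite [RHS]mxE mxE.
  have <- : polar Q (delta_mx 0 i) (delta_mx 0 j) = (Q + Q^T) i j.
    by rewrite /polar trmx_delta -rowE -colE !mxE.
  have /(congr1 pi) := qformD Q (delta_mx 0 i) (delta_mx 0 j).
  by rewrite !rmorphD !q0 !add0r.
by rewrite det0 eqxx.
Qed.

(** The twist replaces [x] by [(c + z) x], whose coordinates are polynomials in the new value;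
    [norm_descent] applies to the characteristic polynomial of that value, and the square of the
    norm of [c + z] is divided out. *)
Lemma norm_value m (Q : 'M[R]_m.+2) (x : 'rV[S]_m.+2) (A : 'M[R]_n.+1) :
  regular_qform Q -> qform (map_mx f Q) x \is a GRing.unit ->
  mul_matrix f c (qform (map_mx f Q) x) A -> Dq Q (\det A).
Proof.
move=> regQ; set s := qform _ x => us sA.
have [z [A' [B [sA' krA' cB uB]]]] := primitive_twist us.
have A'E : A' = A *m (B *m B).
  by apply: (mul_matrix_inj ext sA'); apply: mul_matrixM sA _; apply: mul_matrixM.
have [v0 v0E] : exists v : 'I_m.+2 -> {poly R}, forall i,
    (c + z%:R) * x 0 i = (map_poly f (v i)).[s * (c + z%:R) ^+ 2].
  apply: (fin_all_exists (P := fun i v => (c + z%:R) * x 0 i = (map_poly f v).[s * (c + z%:R) ^+ 2])).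
  by move=> i; apply: (krylov_primitive ext _ sA').
pose v : 'rV[{poly R}]_m.+2 := \row_i v0 i.
have qv : char_poly A' %| qform (map_mx polyC Q) v - 'X.
  apply: char_poly_dvd_krylov krA' _.
  suff -> : horner_mx A' (qform (map_mx polyC Q) v - 'X) = 0 by rewrite linear0.
  apply: (mul_matrix0 ext).
  have := mul_matrix_horner (qform (map_mx polyC Q) v - 'X) sA'.
  suff -> : (map_poly f (qform (map_mx polyC Q) v - 'X)).[s * (c + z%:R) ^+ 2] = 0 by [].
  rewrite rmorphB /= map_polyX hornerD hornerN hornerX map_qform.
  rewrite -[X in X - _]/(horner_eval (s * (c + z%:R) ^+ 2) _) map_qform.
  have -> : map_mx (horner_eval (s * (c + z%:R) ^+ 2)) (map_mx (map_poly f) v) = (c + z%:R) *: x.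
    by apply/rowP=> i; rewrite !mxE v0E.
  have -> : map_mx (horner_eval (s * (c + z%:R) ^+ 2)) (map_mx (map_poly f) (map_mx polyC Q)) = map_mx f Q.
    by apply/matrixP=> i j; rewrite !mxE /= map_polyC /horner_eval hornerC.
  by rewrite qformZ mulrC subrr.
have detA' : \det A' = \det A * \det B ^+ 2 by rewrite A'E !det_mulmx expr2.
have uA' : \det A' \is a GRing.unit.
  by rewrite detA' unitrM unitrX // andbT (norm_unit ext us sA).
have := norm_descent locR char0 regQ (char_poly_monic A') (size_char_poly A') _ qv.
(* The constant term of the characteristic polynomial is the determinant up to the sign already
   present in [norm_descent], so the two signs cancel. *)
rewrite char_poly_det unitrM uA' unitrX ?unitrN1 // mulrA -expr2 sqrr_sign mul1r.
move=> /(_ isT); rewrite detA' => DA.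
rewrite -[\det A](mulrK (_ : \det B ^+ 2 \is a GRing.unit)) ?unitrX //.
by apply: DqM => //; apply: DqV; apply: Dq_square.
Qed.
End NormOfValue.

(** Here [q(x) = a x^2], with [a] a value of [q] and a unit because [2 a] is one; the norm is
    [a^(n+1)] times the square of the norm of [x]. *)
Lemma norm_value_rank1 (R : idomainType) (S : comUnitRingType)
    (f : {rmorphism R -> S}) n (c : S) (Q : 'M[R]_1) (x : 'rV[S]_1) (A : 'M[R]_n.+1) :
  simple_extension f n.+1 c -> local_ring R ->
  regular_qform Q -> qform (map_mx f Q) x \is a GRing.unit ->
  mul_matrix f c (qform (map_mx f Q) x) A -> Dq Q (\det A).
Proof.
move=> ext locR regQ us sA; set a := Q 0 0.
have qE (T : comNzRingType) (P : 'M[T]_1) y : qform P y = P 0 0 * (y 0 0 * y 0 0).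
  by rewrite /qform !mxE big_ord1 !mxE big_ord1; ring.
have aE : a = qform Q (const_mx 1) by rewrite qE mxE !mulr1.
have ua : a \is a GRing.unit.
  move: regQ; rewrite /regular_qform det_mx11 !mxE -/a -mulr2n -mulr_natl unitrM.
  by case/andP.
have sE : qform (map_mx f Q) x = f a * (x 0 0 * x 0 0) by rewrite qE mxE.
have [X xX] := mul_matrix_exists ext (x 0 0).
have ux : x 0 0 \is a GRing.unit by move: us; rewrite sE !unitrM => /and3P[].
have -> : A = a%:M *m (X *m X).
  apply: (mul_matrix_inj ext sA); rewrite sE.
  by apply: mul_matrixM; [apply: mul_matrixC|apply: mul_matrixM].
rewrite !det_mulmx det_scalar -expr2; apply: DqM.
  by apply: DqX; rewrite aE; apply: Dq_value; rewrite -aE.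
exact: (Dq_square locR regQ (norm_unit ext ux xX)).
Qed.

(** * From single values to the group they generate *)

Theorem theorem4p2 (R : idomainType) (S : comUnitRingType)
    (f : {rmorphism R -> S}) (n m : nat) (c : S) (Q : 'M[R]_m) :
  local_ring R ->
  residue_char0 R ->
  injective f ->
  simple_extension f n c ->
  regular_qform Q ->
  forall (s : S) (r : R),
    Dq (map_mx f Q) s -> is_norm f n c s r -> Dq Q r.
Proof.
move=> locR char0 _ ext regQ s r Ds [A [sA ->]].
(* An empty basis would force [1 = 0] in [S]. *)
case: n => [|n] in ext A sA *.
  have [_ gen _] := ext; have [a] := gen 1.
  by rewrite big_ord0 => /eqP; rewrite oner_eq0.
have norm_val x A' : qform (map_mx f Q) x \is a GRing.unit ->
    mul_matrix f c (qform (map_mx f Q) x) A' -> Dq Q (\det (A' : 'M_n.+1)).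
  case: m => [|[|m]] in Q regQ x Ds * => us xA.
  (* In rank 0 the only value is 0, which is not a unit. *)
  - by move: us; rewrite /qform mxE big_ord0 unitr0.
  - exact: norm_value_rank1 ext locR regQ us xA.
  exact: (norm_value ext locR char0 regQ us xA).
elim: Ds A sA => [|_ y [x ->] ux _ IHy|_ y [x ->] ux _ IHy] A sA.
- rewrite -(rmorph1 f) in sA; rewrite (mul_matrix_inj ext sA (mul_matrixC _ _ _)).
  by rewrite det1; apply: gen_units1.
- have [X xX] := mul_matrix_exists ext (qform (map_mx f Q) x).
  have [Y yY] := mul_matrix_exists ext y.
  rewrite (mul_matrix_inj ext sA (mul_matrixM xX yY)) det_mulmx.
  by apply: DqM; [apply: norm_val xX|apply: IHy].
have [X xX] := mul_matrix_exists ext (qform (map_mx f Q) x).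
have [Y yY] := mul_matrix_exists ext y.
(* [A] belongs to [q(x)^-1 y], so its determinant is the quotient of those of [Y] and [X]. *)
have YE : Y = X *m A.
  apply: (mul_matrix_inj ext yY); have := mul_matrixM xX sA.
  by rewrite mulVKr.
have DX : Dq Q (\det X) by apply: norm_val xX.
have := IHy Y yY; rewrite YE det_mulmx => DXA.
by rewrite -[\det A](mulKr (Dq_unit DX)); apply: DqM => //; apply: DqV.
Qed.
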